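(* For every $n\ge 3$, $$\mathrm{Id}(M_n(S_7))=\mathrm{Id}(M_3(S_7)),$$ equivalently, $\mathsf V(M_n(S_7))=\mathsf V(M_3(S_7))$. Moreover, $$\mathsf V(S_7)<\mathsf V(M_2(S_7))<\mathsf V(M_3(S_7)),$$ where $<$ denotes proper inclusion of varieties. Consequently, the chain of varieties $\mathsf V(M_n(S_7))$, $n\ge 1$, has exactly three distinct members.
   Context: An additively idempotent semiring (ai-semiring) is an algebra $(S,+,\cdot)$ in the signature of two binary operations (no constants) whose additive reduct is a commutative idempotent semigroup, whose multiplicative reduct is a semigroup, and in which multiplication distributes over addition on both sides. $\mathsf V(S)$ denotes the variety generated by $S$, and $\mathrm{Id}(S)$ the equational theory of $S$ (the set of all identities between ai-semiring terms valid in $S$). $S_7=\{1,a,\infty\}$ is the ai-semiring with addition $x+x=x$ and $x+y=\infty$ for $x\ne y$, and with commutative multiplication $1\cdot 1=1$, $1\cdot a=a\cdot 1=a$, $a\cdot a=\infty$, $x\cdot\infty=\infty\cdot x=\infty$ for all $x$. For an ai-semiring $S$ and $n\ge1$, $M_n(S)$ is the ai-semiring of all $n\times n$ matrices over $S$ with entrywise addition and the usual matrix multiplication $(AB)_{ij}=\sum_{k=1}^n A_{ik}B_{kj}$. $M_1(S)$ is identified with $S$. *)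

(* Defs.v *)
From mathcomp Require Import all_boot all_algebra.
From mathcomp Require Import boolp classical_sets.

Set Implicit Arguments.
Unset Strict Implicit.
Unset Printing Implicit Defensive.

Local Open Scope classical_set_scope.

(* As usual in universal algebra, carriers are nonempty; neither a zero nor
   a one is part of the signature. *)
Record aiSemiring := AiSemiring {
  car :> Type;
  ai_add : car -> car -> car;
  ai_mul : car -> car -> car;
  ai_nonempty : inhabited car;
  ai_addA : associative ai_add;
  ai_addC : commutative ai_add;
  ai_addxx : idempotent_op ai_add;
  ai_mulA : associative ai_mul;
  ai_mulDl : left_distributive ai_mul ai_add;
  ai_mulDr : right_distributive ai_mul ai_add }.

Declare Scope ai_scope.
Delimit Scope ai_scope with ai.
Notation "x + y" := (ai_add x y) : ai_scope.
Notation "x * y" := (ai_mul x y) : ai_scope.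
Local Open Scope ai_scope.

Definition is_hom (A B : aiSemiring) (f : A -> B) : Prop :=
  (forall x y, f (x + y) = f x + f y) /\ (forall x y, f (x * y) = f x * f y).

Section Product.
Variables (I : Type) (A : I -> aiSemiring).

Let T := forall i, A i.
Let add (f g : T) : T := fun i => f i + g i.
Let mul (f g : T) : T := fun i => f i * g i.

Let nonempty : inhabited T.
Proof.
have ex_pt i : exists x : A i, True by case: (ai_nonempty (A i)) => x; exists x.
exact: (inhabits (fun i => sval (cid (ex_pt i)))).
Qed.

Let addA : associative add.
Proof. by move=> f g h; apply: functional_extensionality_dep => i; exact: ai_addA. Qed.
Let addC : commutative add.
Proof. by move=> f g; apply: functional_extensionality_dep => i; exact: ai_addC. Qed.
Let addxx : idempotent_op add.
Proof. by move=> f; apply: functional_extensionality_dep => i; exact: ai_addxx. Qed.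
Let mulA : associative mul.
Proof. by move=> f g h; apply: functional_extensionality_dep => i; exact: ai_mulA. Qed.
Let mulDl : left_distributive mul add.
Proof. by move=> f g h; apply: functional_extensionality_dep => i; exact: ai_mulDl. Qed.
Let mulDr : right_distributive mul add.
Proof. by move=> f g h; apply: functional_extensionality_dep => i; exact: ai_mulDr. Qed.

Definition ai_prod : aiSemiring :=
  AiSemiring nonempty addA addC addxx mulA mulDl mulDr.

End Product.

(* Classes are plain predicates: the universe of [set] is too small for
   [set aiSemiring]. *)
Definition ai_class := aiSemiring -> Prop.

Definition subclass (K L : ai_class) : Prop := forall T, K T -> L T.
Definition proper_subclass (K L : ai_class) : Prop :=
  subclass K L /\ ~ subclass L K.

(* A variety is a class closed under homomorphic images, (isomorphic copies
   of) subalgebras and arbitrary direct products. *)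
Definition is_variety (K : ai_class) : Prop :=
  [/\ forall (A B : aiSemiring) (f : A -> B),
        K A -> is_hom f -> (forall y, exists x, f x = y) -> K B,
      forall (A B : aiSemiring) (f : B -> A),
        K A -> is_hom f -> injective f -> K B
    & forall (I : Type) (A : I -> aiSemiring),
        (forall i, K (A i)) -> K (ai_prod A)].

Definition variety_of (S : aiSemiring) : ai_class :=
  fun T => forall K : ai_class, is_variety K -> K S -> K T.

Inductive term : Type :=
| Var of nat
| Add of term & term
| Mul of term & term.

Fixpoint eval (S : aiSemiring) (v : nat -> S) (t : term) : S :=
  match t with
  | Var i => v i
  | Add t1 t2 => eval v t1 + eval v t2
  | Mul t1 t2 => eval v t1 * eval v t2
  end.

Definition Id (S : aiSemiring) : set (term * term) :=
  [set e | forall v : nat -> S, eval v e.1 = eval v e.2].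

Section Matrix.
Variables (n : nat) (S : aiSemiring).

(* There is no neutral element, so the first summand replaces the default
   value of the iterated sum. *)
Definition ai_sum (m : nat) (F : 'I_m.+1 -> S) : S :=
  \big[@ai_add S/F ord0]_(k < m) F (lift ord0 k).

(* M_n(S) for n >= 1: the dimension n.-1.+1 is n (the value at n = 0 is
   irrelevant). *)
Definition ai_mx_add (A B : 'M[S]_(n.-1.+1)) : 'M[S]_(n.-1.+1) :=
  (\matrix_(i, j) (A i j + B i j)%ai)%R.
Definition ai_mx_mul (A B : 'M[S]_(n.-1.+1)) : 'M[S]_(n.-1.+1) :=
  (\matrix_(i, j) ai_sum (fun k => A i k * B k j)%ai)%R.

Let addACA (a b c d : S) : (a + b) + (c + d) = (a + c) + (b + d).
Proof. by rewrite -!ai_addA (ai_addA b) (ai_addC b) -ai_addA. Qed.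

Let big_split J (r : seq J) (x y : S) (F G : J -> S) :
  \big[@ai_add S/x + y]_(k <- r) (F k + G k) =
  \big[@ai_add S/x]_(k <- r) F k + \big[@ai_add S/y]_(k <- r) G k.
Proof.
elim: r => [|k r IHr]; first by rewrite !big_nil.
by rewrite !big_cons IHr addACA.
Qed.

Let ai_sumD m (F G : 'I_m.+1 -> S) :
  ai_sum (fun k => F k + G k) = ai_sum F + ai_sum G.
Proof. exact: big_split. Qed.

Let eq_ai_sum m (F G : 'I_m.+1 -> S) : F =1 G -> ai_sum F = ai_sum G.
Proof. by move=> eqFG; rewrite /ai_sum eqFG; apply: eq_bigr => k _. Qed.

Let ai_mulr_sum m x (F : 'I_m.+1 -> S) :
  x * ai_sum F = ai_sum (fun k => x * F k).
Proof. by rewrite /ai_sum; apply: big_morph => // y z; exact: ai_mulDr. Qed.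

Let ai_mull_sum m x (F : 'I_m.+1 -> S) :
  ai_sum F * x = ai_sum (fun k => F k * x).
Proof.
by rewrite /ai_sum; apply: (big_morph (fun y => y * x)) => // y z; exact: ai_mulDl.
Qed.

Let exchange_ai_sum m p (F : 'I_m.+1 -> 'I_p.+1 -> S) :
  ai_sum (fun k => ai_sum (F k)) = ai_sum (fun l => ai_sum (F^~ l)).
Proof.
rewrite [LHS]/ai_sum [RHS](@eq_ai_sum _ _
  (fun l => \big[@ai_add S/F ord0 l]_(k < m) F (lift ord0 k) l)) //.
elim: (index_enum _) => [|k r IHr].
  by rewrite big_nil; apply: eq_ai_sum => l; rewrite big_nil.
rewrite big_cons IHr -ai_sumD.
by apply: eq_ai_sum => l; rewrite big_cons.
Qed.

Let nonempty : inhabited 'M[S]_(n.-1.+1).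
Proof. by case: (ai_nonempty S) => x; exact: (inhabits (const_mx x)). Qed.
Let addA : associative ai_mx_add.
Proof. by move=> A B C; apply/matrixP => i j; rewrite !mxE ai_addA. Qed.
Let addC : commutative ai_mx_add.
Proof. by move=> A B; apply/matrixP => i j; rewrite !mxE ai_addC. Qed.
Let addxx : idempotent_op ai_mx_add.
Proof. by move=> A; apply/matrixP => i j; rewrite !mxE ai_addxx. Qed.
Let mulA : associative ai_mx_mul.
Proof.
move=> A B C; apply/matrixP => i j; rewrite !mxE.
transitivity (ai_sum (fun k => ai_sum (fun l => A i k * B k l * C l j))).
  apply: eq_ai_sum => k; rewrite mxE ai_mulr_sum.
  by apply: eq_ai_sum => l; rewrite ai_mulA.
by rewrite exchange_ai_sum; apply: eq_ai_sum => l; rewrite mxE ai_mull_sum.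
Qed.
Let mulDl : left_distributive ai_mx_mul ai_mx_add.
Proof.
move=> A B C; apply/matrixP => i j; rewrite !mxE -ai_sumD.
by apply: eq_ai_sum => k; rewrite mxE ai_mulDl.
Qed.
Let mulDr : right_distributive ai_mx_mul ai_mx_add.
Proof.
move=> A B C; apply/matrixP => i j; rewrite !mxE -ai_sumD.
by apply: eq_ai_sum => k; rewrite mxE ai_mulDr.
Qed.

Definition ai_mx : aiSemiring :=
  AiSemiring nonempty addA addC addxx mulA mulDl mulDr.

End Matrix.

Inductive S7_car : Type := S7_one | S7_a | S7_inf.

Definition S7_add (x y : S7_car) : S7_car :=
  match x, y with
  | S7_one, S7_one => S7_one
  | S7_a, S7_a => S7_a
  | _, _ => S7_inf
  end.

Definition S7_mul (x y : S7_car) : S7_car :=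
  match x, y with
  | S7_one, z | z, S7_one => z
  | _, _ => S7_inf
  end.

Lemma S7_addA : associative S7_add. Proof. by do 3![case]. Qed.
Lemma S7_addC : commutative S7_add. Proof. by do 2![case]. Qed.
Lemma S7_addxx : idempotent_op S7_add. Proof. by case. Qed.
Lemma S7_mulA : associative S7_mul. Proof. by do 3![case]. Qed.
Lemma S7_mulDl : left_distributive S7_mul S7_add. Proof. by do 3![case]. Qed.
Lemma S7_mulDr : right_distributive S7_mul S7_add. Proof. by do 3![case]. Qed.

Definition S7 : aiSemiring :=
  AiSemiring (inhabits S7_one) S7_addA S7_addC S7_addxx S7_mulA S7_mulDl S7_mulDr.

(* Main.v *)
Require Import Defs.
From mathcomp Require Import all_boot all_algebra zify.
From mathcomp Require Import boolp classical_sets.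

Set Implicit Arguments.
Unset Strict Implicit.
Unset Printing Implicit Defensive.

(** Why the theorem holds.  Give the elements 1, a, oo of S7 the weights 0, 1, 2.
Multiplication becomes addition of weights truncated at 2, and a sum has a
finite value c only if all its summands equal c.  Hence, when a term is expanded
into a sum of words, the (i, j) entry of its value on a tuple of matrices is a
finite c exactly when every walk from i to j reading a word of the term has
total weight wt c ([eval_entryP]).

Varieties grow with the dimension: pulling matrices back along a surjection of
index sets embeds M_m(S7) into M_n(S7) for m <= n, addition being idempotent
([variety_of_mx_le]).

They stop growing at dimension 3 ([eval_entry_transfer]).  Let s = t hold in
M_3(S7), and let the (i, j) entry of s in M_n(S7) be a finite c.  Pulling back
along maps from a 3-element index set shows that all walks of t with vertices
among i, j and one further index k have weight wt c.  For arbitrary walks,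
observe that a letter occurring strictly inside a word of t also occurs strictly
inside a word of s ([Id_inner_letter]); since all walks of s have equal weights,
the weight matrix of such a letter is a sum of a function of the row and a
function of the column ([inner_letter_modular]).  So the weight of a walk of t is
a sum of functions of its separate vertices, and each vertex can be moved to i
without changing the weight, as this already holds for walks on i, j and k.  The
M_n(S7) being countable, equality of equational theories gives equality of
varieties by the easy case of Birkhoff's theorem ([Id_variety_of]).

The first inclusions are strict.  Commutativity of multiplication holds in S7
but not in M_2(S7).  Next, let s be x + x^2 + y + y^2.  In M_2(S7), s absorbs
x y: if s has the finite entry a at (i, j), then i <> j, both x and y have a at
(i, j) and 1 on the diagonal, so x y has the entry a as well; an entry 1 of s forces
all entries that x y reads to be 1.  In M_3(S7) a third
index k comes in, of whose entries x_ik, x_kj exactly one has to be a, and likewise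
for y; opposite choices for x and y give a walk from i through k to j reading x y with weight 2. *)

(** * Varieties and identities *)

Lemma is_hom_eval (A B : aiSemiring) (f : A -> B) (v : nat -> A) t :
  is_hom f -> f (eval v t) = eval (f \o v) t.
Proof.
by case=> fD fM; elim: t => [x|t1 IH1 t2 IH2|t1 IH1 t2 IH2] //=;
   rewrite ?fD ?fM IH1 IH2.
Qed.

Lemma eval_prod I (A : I -> aiSemiring) (v : nat -> ai_prod A) t i :
  eval v t i = eval (fun x => v x i) t.
Proof. by elim: t => [x|t1 IH1 t2 IH2|t1 IH1 t2 IH2] //=; rewrite -IH1 -IH2. Qed.

Lemma models_variety e : is_variety (fun T => Id T e).
Proof.
split=> [A B f Ae hf surj w | A B f Ae hf inj_f v | I A Ae v].
- have [v fv] := choice (fun x => surj (w x)).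
  have -> : w = f \o v by apply: funext => x /=; rewrite fv.
  by rewrite -!is_hom_eval // Ae.
- by apply: inj_f; rewrite !is_hom_eval // Ae.
by apply: functional_extensionality_dep => i; rewrite !eval_prod; exact: Ae.
Qed.

Lemma variety_of_refl S : variety_of S S. Proof. by move=> K. Qed.

Lemma variety_of_sub A B : variety_of B A -> subclass (variety_of A) (variety_of B).
Proof. by move=> BA T AT K varK KB; exact: (AT K varK (BA K varK KB)). Qed.

Lemma variety_of_embedding (A B : aiSemiring) (f : B -> A) :
  is_hom f -> injective f -> variety_of A B.
Proof. by move=> hf inj_f K [_ subK _] KA; exact: (subK A B f KA hf inj_f). Qed.

Lemma variety_of_Id A B e : variety_of A B -> Id A e -> Id B e.
Proof. by move=> AB; exact: (AB _ (models_variety e)). Qed.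

Section Subalgebra.
Variables (A : aiSemiring) (P : A -> Prop).
Hypotheses (P0 : exists x, P x)
  (PD : forall x y, P x -> P y -> P (ai_add x y))
  (PM : forall x y, P x -> P y -> P (ai_mul x y)).

Let T := {x : A | P x}.
Let add (x y : T) : T := exist P _ (PD (svalP x) (svalP y)).
Let mul (x y : T) : T := exist P _ (PM (svalP x) (svalP y)).

Lemma sval_inj : injective (@sval A P).
Proof. by case=> x px [y py] /= exy; exact: eq_exist. Qed.

Let nonempty : inhabited T.
Proof. by case: P0 => x Px; exact: (inhabits (exist P x Px)). Qed.
Let addA : associative add.
Proof. by move=> x y z; apply: sval_inj; exact: ai_addA. Qed.
Let addC : commutative add.
Proof. by move=> x y; apply: sval_inj; exact: ai_addC. Qed.
Let addxx : idempotent_op add.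
Proof. by move=> x; apply: sval_inj; exact: ai_addxx. Qed.
Let mulA : associative mul.
Proof. by move=> x y z; apply: sval_inj; exact: ai_mulA. Qed.
Let mulDl : left_distributive mul add.
Proof. by move=> x y z; apply: sval_inj; exact: ai_mulDl. Qed.
Let mulDr : right_distributive mul add.
Proof. by move=> x y z; apply: sval_inj; exact: ai_mulDr. Qed.

Definition ai_sub : aiSemiring :=
  AiSemiring nonempty addA addC addxx mulA mulDl mulDr.

Lemma sval_is_hom : is_hom (fun x : ai_sub => sval x : A).
Proof. by []. Qed.

End Subalgebra.

(** The case of Birkhoff's theorem for a countable algebra [B]: the value of a
term on a fixed enumeration of [B] depends only on the function that the term
induces on [A], because the identities of [A] hold in [B].  So [B] is an image of
the algebra of term functions of [A] in countably many variables, which lies in a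
power of [A]. *)
Lemma Id_variety_of (A B : aiSemiring) (b : nat -> B) :
  (forall y, exists k, b k = y) -> subset (Id A) (Id B) -> variety_of A B.
Proof.
move=> b_onto AB K [imK subK prodK] KA.
pose F := ai_prod (fun _ : nat -> A => A).
pose tm t : F := fun v => eval v t.
pose P (x : F) := exists t, x = tm t.
have P0 : exists x, P x by exists (tm (Var 0)), (Var 0).
have PD x y : P x -> P y -> P (ai_add x y).
  by move=> [s ->] [t ->]; exists (Add s t).
have PM x y : P x -> P y -> P (ai_mul x y).
  by move=> [s ->] [t ->]; exists (Mul s t).
pose G := ai_sub P0 PD PM.
have KG : K G.
  by apply: (subK F G _ (prodK _ _ (fun=> KA)) (sval_is_hom _ _ _)) (@sval_inj _ _).
pose rep (x : G) : term := sval (cid (svalP x)).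
have evalB s t : tm s = tm t -> eval b s = eval b t.
  by move=> est; apply: (AB (s, t)) => v; exact: (congr1 (fun f : F => f v) est).
have repE (x : G) : sval x = tm (rep x) by exact: (svalP (cid (svalP x))).
apply: (imK G B (fun x => eval b (rep x)) KG).
  split=> x y.
    by apply: (evalB _ (Add (rep x) (rep y))); rewrite -repE /= !repE.
  by apply: (evalB _ (Mul (rep x) (rep y))); rewrite -repE /= !repE.
move=> y; have [k <-] := b_onto y.
have Pk : P (tm (Var k)) by exists (Var k).
by exists (exist P _ Pk); apply: (evalB _ (Var k)); rewrite -repE.
Qed.

(** * Weights in S7 *)

Definition wt (x : S7_car) : nat :=
  match x with S7_one => 0 | S7_a => 1 | S7_inf => 2 end.

Definition of_wt (d : nat) : S7_car :=
  match d with 0 => S7_one | 1 => S7_a | _ => S7_inf end.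

Lemma wtK : cancel wt of_wt. Proof. by case. Qed.
Lemma wt_inj : injective wt. Proof. exact: can_inj wtK. Qed.

Lemma wt_le1 c : c <> S7_inf -> wt c <= 1. Proof. by case: c. Qed.

Lemma of_wt_le1 d : d <= 1 -> of_wt d <> S7_inf /\ wt (of_wt d) = d.
Proof. by case: d => [|[|d]]. Qed.

Lemma S7_addP x y c : c <> S7_inf -> S7_add x y = c <-> x = c /\ y = c.
Proof. by case: c x y => [||] [||] [||] //= _; split=> // -[]. Qed.

Lemma S7_mulP x y c :
  c <> S7_inf -> S7_mul x y = c <-> wt x + wt y = wt c.
Proof. by case: c x y => [||] [||] [||]. Qed.

Lemma S7_eqP x y :
  (forall c, c <> S7_inf -> x = c <-> y = c) -> x = y.
Proof.
move=> xy; have [xf|xi] := pselect (x = S7_inf); last by rewrite ((xy _ xi).1 erefl).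
have [yf|yi] := pselect (y = S7_inf); first by rewrite xf yf.
by rewrite ((xy _ yi).2 erefl).
Qed.

Lemma ai_sum_S7P m (F : 'I_m.+1 -> S7) c :
  c <> S7_inf -> ai_sum F = c <-> forall k, F k = c.
Proof.
move=> cfin; rewrite /ai_sum.
have big_eq (r : seq 'I_m) x : \big[@ai_add S7/x]_(k <- r) F (lift ord0 k) = c <->
    x = c /\ forall k, k \in r -> F (lift ord0 k) = c.
  elim: r => [|k r IH]; first by rewrite big_nil; split=> // -[].
  rewrite big_cons; split=> [/(S7_addP _ _ cfin)[Fk /IH[xc Fr]]|[xc Fr]].
    by split=> // l; rewrite inE => /predU1P[->|/Fr].
  apply/S7_addP => //; split; first by apply: Fr; rewrite mem_head.
  by apply/IH; split=> // l lr; apply: Fr; rewrite inE lr orbT.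
split=> [/big_eq[F0 Fl] k|Fc].
  by case: (unliftP ord0 k) => [l|] -> //; apply: Fl; rewrite mem_index_enum.
by apply/big_eq; split.
Qed.

(** * Matrices over S7 *)

(** Gives the elements of the algebra [ai_mx n S7] their matrix coefficients; the
carrier has to be unfolded before the coercion of matrices to functions applies. *)
Definition entry n (A : ai_mx n S7) : 'I_n.-1.+1 -> 'I_n.-1.+1 -> S7_car :=
  fun i j => (A : 'M[S7]_(n.-1.+1)) i j.

Lemma entry_inj n (A B : ai_mx n S7) : (forall i j, entry A i j = entry B i j) -> A = B.
Proof. by move=> AB; apply/matrixP. Qed.

Lemma entryD n (A B : ai_mx n S7) i j :
  entry (ai_add A B) i j = S7_add (entry A i j) (entry B i j).
Proof. by rewrite /entry mxE. Qed.

Lemma entryMP n (A B : ai_mx n S7) i j c : c <> S7_inf ->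
  entry (ai_mul A B) i j = c <->
  forall k, wt (entry A i k) + wt (entry B k j) = wt c.
Proof.
move=> cfin; rewrite /entry mxE ai_sum_S7P //.
by split=> H k; have /(S7_mulP _ _ cfin) := H k.
Qed.

Definition reindex_mx m n (phi : 'I_n.-1.+1 -> 'I_m.-1.+1) (A : ai_mx m S7) :
  ai_mx n S7 := (\matrix_(p, q) entry A (phi p) (phi q))%R.

Lemma entry_reindex m n (phi : 'I_n.-1.+1 -> 'I_m.-1.+1) A p q :
  entry (reindex_mx phi A) p q = entry A (phi p) (phi q).
Proof. by rewrite /entry mxE. Qed.

(** A path of length two through an index of the larger set reads the same entries
as one through its image; surjectivity provides every path, and repeated summands
do not matter. *)
Lemma reindex_mx_hom m n (phi : 'I_n.-1.+1 -> 'I_m.-1.+1) :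
  (forall q, exists p, phi p = q) -> is_hom (reindex_mx phi).
Proof.
move=> onto; split=> A B; apply: entry_inj => i j.
  by rewrite entryD !entry_reindex entryD.
apply: S7_eqP => c cfin; rewrite entry_reindex !entryMP //; split=> H k.
  by rewrite !entry_reindex.
by have [p <-] := onto k; have := H p; rewrite !entry_reindex.
Qed.

Lemma reindex_mx_inj m n (phi : 'I_n.-1.+1 -> 'I_m.-1.+1) :
  (forall q, exists p, phi p = q) -> injective (reindex_mx phi).
Proof.
move=> onto A B AB; apply: entry_inj => i j.
have [p <-] := onto i; have [q <-] := onto j.
by rewrite -!entry_reindex AB.
Qed.

Lemma variety_of_mx_le m n : m <= n -> variety_of (ai_mx n S7) (ai_mx m S7).
Proof.
move=> le_mn; pose phi (p : 'I_n.-1.+1) : 'I_m.-1.+1 := inord p.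
have le_mn' : m.-1.+1 <= n.-1.+1 by lia.
have onto q : exists p, phi p = q.
  by exists (widen_ord le_mn' q); rewrite /phi inord_val.
exact: variety_of_embedding (reindex_mx_hom onto) (reindex_mx_inj onto).
Qed.

(** Needed to apply [Id_variety_of], whose terms have countably many variables. *)
Lemma mx_S7_countable n : exists b : nat -> ai_mx n S7, forall A, exists k, b k = A.
Proof.
pose M := 'M[nat]_(n.-1.+1).
exists (fun k => map_mx of_wt (odflt (const_mx 0) (unpickle k : option M))) => A.
exists (pickle (map_mx wt (A : 'M[S7]_(n.-1.+1)))).
by rewrite pickleK; apply: entry_inj => i j; rewrite /entry !mxE wtK.
Qed.

(** * Walks and entries of values of terms *)

(** The summands of a term after full expansion by distributivity. *)
Fixpoint words (t : term) : seq (seq nat) :=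
  match t with
  | Var x => [:: [:: x]]
  | Add t1 t2 => words t1 ++ words t2
  | Mul t1 t2 => [seq u ++ w | u <- words t1, w <- words t2]
  end.

Lemma words_nonempty t : exists w, w \in words t.
Proof.
elim: t => [x|t1 [u u1] t2 _|t1 [u u1] t2 [w w2]] /=; first by exists [:: x]; exact: mem_head.
  by exists u; rewrite mem_cat u1.
by exists (u ++ w); apply/allpairsP; exists (u, w).
Qed.

Lemma size_word t w : w \in words t -> 0 < size w.
Proof.
elim: t w => [x|t1 IH1 t2 IH2|t1 IH1 t2 IH2] w /=.
- by rewrite inE => /eqP ->.
- by rewrite mem_cat => /orP[/IH1|/IH2].
by case/allpairsP => -[u v] /= [/IH1 u0 _ ->]; rewrite size_cat ltn_addr.
Qed.

Section Weight.
Variables (I : Type) (f : nat -> I -> I -> nat).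
Implicit Type K : nat -> I.

(** The total weight of the walk [K 0, K 1, ...] reading the letters of [w], a step
from [p] to [q] reading [x] having weight [f x p q].  Vertices are given by a
function on all of [nat], so that walks can be modified without side conditions on
lengths; only the values up to [size w] count. *)
Definition weight (w : seq nat) K :=
  \sum_(l < size w) f (nth 0 w l) (K l) (K l.+1).

Lemma weight1 x K : weight [:: x] K = f x (K 0) (K 1).
Proof. by rewrite /weight big_ord1. Qed.

Lemma weight_cons x w K : weight (x :: w) K = f x (K 0) (K 1) + weight w (fun l => K l.+1).
Proof. by rewrite /weight big_ord_recl. Qed.

Lemma weight_cat u w K :
  weight (u ++ w) K = weight u K + weight w (fun l => K (size u + l)).
Proof.
elim: u K => [|x u IH] K /=; first by rewrite {2}/weight big_ord0.
by rewrite !weight_cons IH addnA.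
Qed.

Lemma eq_weight w K1 K2 :
  (forall l, l <= size w -> K1 l = K2 l) -> weight w K1 = weight w K2.
Proof.
move=> eqK; apply: eq_bigr => l _.
by rewrite !eqK // ltnW.
Qed.

Lemma weight_exchange w K1 K2 K3 K4 :
  (forall l, l < size w ->
    f (nth 0 w l) (K1 l) (K1 l.+1) + f (nth 0 w l) (K2 l) (K2 l.+1) =
    f (nth 0 w l) (K3 l) (K3 l.+1) + f (nth 0 w l) (K4 l) (K4 l.+1)) ->
  weight w K1 + weight w K2 = weight w K3 + weight w K4.
Proof. by move=> eqf; rewrite /weight -!big_split; apply: eq_bigr => l _; exact: eqf. Qed.

End Weight.

Definition walk I (w : seq nat) (i j : I) (K : nat -> I) :=
  K 0 = i /\ K (size w) = j.

Definition entry_wt n (v : nat -> ai_mx n S7) x p q := wt (entry (v x) p q).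

(** For a product the intermediate vertex [k] is free, and the weights of the two
halves of a walk may depend on it.  Finiteness makes the argument work in both
directions: for fixed [k] the sum of the two weights is at most 1, so the value of
either half is finite and can be read off from one walk in the other half. *)
Lemma eval_entryP n (v : nat -> ai_mx n S7) t i j c : c <> S7_inf ->
  entry (eval v t) i j = c <->
  forall w K, w \in words t -> walk w i j K -> weight (entry_wt v) w K = wt c.
Proof.
elim: t i j c => [x|t1 IH1 t2 IH2|t1 IH1 t2 IH2] i j c cfin /=.
- split=> [vc w K|H].
    by rewrite inE => /eqP -> [K0 K1]; rewrite weight1 K0 K1 /entry_wt vc.
  apply: wt_inj; rewrite -(H [:: x] (fun l => if l is 0 then i else j)) ?mem_head //.
  by rewrite weight1.
- rewrite entryD S7_addP // IH1 // IH2 //; split=> [[H1 H2] w K|H].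
    by rewrite mem_cat => /orP[wt1|wt2] wK; [exact: H1 | exact: H2].
  by split=> w K wt wK; apply: H => //; rewrite mem_cat wt ?orbT.
rewrite entryMP //; have c1 := wt_le1 cfin; split=> [H w K|H k].
  case/allpairsP => -[u1 u2] /= [ut1 ut2 ->] [K0 K1].
  have := H (K (size u1)) => Hk.
  have fin1 : entry (eval v t1) i (K (size u1)) <> S7_inf.
    by move=> e; move: Hk; rewrite e /=; lia.
  have fin2 : entry (eval v t2) (K (size u1)) j <> S7_inf.
    by move=> e; move: Hk; rewrite e /=; lia.
  rewrite weight_cat -Hk; congr (_ + _).
    by apply: (IH1 _ _ _ fin1).1.
  apply: (IH2 _ _ _ fin2).1 => //; split; first by rewrite addn0.
  by rewrite -size_cat.
have [u1 ut1] := words_nonempty t1; have [u2 ut2] := words_nonempty t2.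
have walkE I (p q : I) u t : u \in words t ->
    walk u p q (fun l => if l is 0 then p else q).
  by move=> /size_word; case: u.
have combo w1 w2 K1 K2 : w1 \in words t1 -> w2 \in words t2 ->
    walk w1 i k K1 -> walk w2 k j K2 ->
    weight (entry_wt v) w1 K1 + weight (entry_wt v) w2 K2 = wt c.
  move=> wt1 wt2 [K10 K11] [K20 K21].
  pose K l := if l < size w1 then K1 l else K2 (l - size w1).
  rewrite -(H (w1 ++ w2) K); first last.
  - split; first by rewrite /K (size_word wt1).
    by rewrite /K size_cat -ltn_subRL subnn ltn0 addKn.
  - by apply/allpairsP; exists (w1, w2).
  rewrite weight_cat; congr (_ + _); apply: eq_weight => l; rewrite /K.
    by rewrite leq_eqVlt => /predU1P[->|->] //; rewrite ltnn subnn K11 K20.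
  by move=> _; rewrite -ltn_subRL subnn ltn0 addKn.
(* Reference walks in both halves: comparing with them shows that in each half all
   walks have the same weight. *)
pose L1 l := if l is 0 then i else k; pose L2 l := if l is 0 then k else j.
have w1L := walkE _ i k _ _ ut1; have w2L := walkE _ k j _ _ ut2.
have dd := combo _ _ _ _ ut1 ut2 w1L w2L.
set d1 := weight _ u1 _ in dd; set d2 := weight _ u2 _ in dd.
have [] := @of_wt_le1 d1; first lia.
have [] := @of_wt_le1 d2; first lia.
move=> fin2 e2 fin1 e1.
have -> : entry (eval v t1) i k = of_wt d1.
  apply/(IH1 _ _ _ fin1) => w K wt1 wK; rewrite e1.
  by have := combo _ _ _ _ wt1 ut2 wK w2L; rewrite -/d2; lia.
have -> : entry (eval v t2) k j = of_wt d2.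
  apply/(IH2 _ _ _ fin2) => w K wt2 wK; rewrite e2.
  by have := combo _ _ _ _ ut1 wt2 w1L wK; rewrite -/d1; lia.
by rewrite e1 e2.
Qed.

(** * Identities of matrices of order 3 *)

(** A step reading an inner letter is constrained neither by the source nor by the
target of the walk. *)
Definition inner_letter (t : term) x :=
  exists w l, [/\ w \in words t, 0 < l, l.+1 < size w & nth 0 w l = x].

(** If [x] were inner in [t] only, the entries (0, 1) of [s] and [t] would differ when
[x] has oo in the position (2, 2) and all other entries of all letters are 1.  A walk from 0 to 1 meets
the position (2, 2) of [x] only at an inner occurrence of [x]. *)
Lemma Id_inner_letter n s t x : 3 <= n ->
  Id (ai_mx n S7) (s, t) -> inner_letter t x -> inner_letter s x.
Proof.
move=> n3 st [w [l [wt l0 lw xl]]]; apply: contrapT => xNs.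
have n1 : n.-1.+1 = n by lia.
have lt_n r : r <= 2 -> r < n.-1.+1 by lia.
pose i := Ordinal (lt_n 0 isT); pose j := Ordinal (lt_n 1 isT).
pose k := Ordinal (lt_n 2 isT).
pose v y : ai_mx n S7 :=
  (\matrix_(p, q) if [&& y == x, p == k & q == k] then S7_inf else S7_one)%R.
have vE y p q : entry (v y) p q =
    if [&& y == x, p == k & q == k] then S7_inf else S7_one.
  by rewrite /entry mxE.
have one_fin : S7_one <> S7_inf by [].
have s1 : entry (eval v s) i j = S7_one.
  apply/eval_entryP => // u K us [K0 K1]; apply: big1 => m _.
  rewrite /entry_wt vE; case: and3P => // -[/eqP xm /eqP Km /eqP Km1].
  case: xNs; exists u, m; split=> //.
    by case: (posnP m) Km => // ->; rewrite K0.
  have := ltn_ord m; rewrite leq_eqVlt => /predU1P[mu|//].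
  by move: Km1; rewrite mu K1.
pose K m := if m == 0 then i else if m == size w then j else k.
have wK : walk w i j K.
  by split; rewrite /K // eqxx; case: eqP lw => // ->.
have := (eval_entryP v t i j one_fin).1.
rewrite -(st v) => /(_ s1 w K wt wK) /eqP /=.
rewrite sum_nat_eq0 => /forallP /(_ (Ordinal (ltnW lw))) /=.
rewrite /entry_wt vE xl eqxx /K.
by rewrite (gtn_eqF l0) (ltn_eqF (ltnW lw)) (ltn_eqF lw) !eqxx.
Qed.

(** Consider the walks of [s] that read [x] from [p] to [q] and are at [p] all the time
before and at [q] all the time after that step, apart from their end points.  The part
before the step depends on [p] only and the part after it on [q] only.  All these
walks have the same weight, so the weight of [x] is modular in the pair (p, q). *)
Lemma inner_letter_modular n (v : nat -> ai_mx n S7) s i j c x :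
  c <> S7_inf -> entry (eval v s) i j = c -> inner_letter s x ->
  forall k1 k2 l1 l2,
    entry_wt v x k1 l1 + entry_wt v x k2 l2 =
    entry_wt v x k1 l2 + entry_wt v x k2 l1.
Proof.
move=> cfin sc [w [l [ws l0 lw xl]]] k1 k2 l1 l2.
pose K p q m := if m == 0 then i else if m == size w then j
  else if m <= l then p else q.
have wK p q : weight (entry_wt v) w (K p q) = wt c.
  apply: ((eval_entryP v s i j cfin).1 sc) => //; split=> //.
  by rewrite /K eqxx; case: eqP lw => // ->.
have : weight (entry_wt v) w (K k1 l1) + weight (entry_wt v) w (K k2 l2) =
  weight (entry_wt v) w (K k1 l2) + weight (entry_wt v) w (K k2 l1).
  by rewrite !wK.
pose l' := Ordinal (ltnW lw).
have Kl p q : K p q l = p by rewrite /K leqnn (gtn_eqF l0) (ltn_eqF (ltnW lw)).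
have Kl1 p q : K p q l.+1 = q by rewrite /K ltnn (ltn_eqF lw).
have rest (m : 'I_(size w)) : m != l' ->
    entry_wt v (nth 0 w m) (K k1 l1 m) (K k1 l1 m.+1) +
    entry_wt v (nth 0 w m) (K k2 l2 m) (K k2 l2 m.+1) =
    entry_wt v (nth 0 w m) (K k1 l2 m) (K k1 l2 m.+1) +
    entry_wt v (nth 0 w m) (K k2 l1 m) (K k2 l1 m.+1).
  have Kle p q q' r : r <= l -> K p q r = K p q' r by rewrite /K => ->.
  have Kgt p p' q r : l < r -> K p q r = K p' q r by move=> lr; rewrite /K leqNgt lr.
  rewrite -val_eqE neq_ltn => /orP[ml|lm].
    by rewrite !(Kle _ l1 l2) // ltnW.
  by rewrite !(Kgt k1 k2 _ m lm) !(Kgt k1 k2 _ m.+1 (ltnW lm)) addnC.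
have weightD1 p q : weight (entry_wt v) w (K p q) = entry_wt v x p q +
    \sum_(m < size w | m != l') entry_wt v (nth 0 w m) (K p q m) (K p q m.+1).
  by rewrite /weight (bigD1 l') //= xl Kl Kl1.
rewrite !weightD1 addnACA [RHS]addnACA -!big_split /=.
by rewrite (eq_bigr _ rest) => /addIn.
Qed.

Lemma weight_reindex m n (phi : 'I_n.-1.+1 -> 'I_m.-1.+1) (v : nat -> ai_mx m S7) w K :
  weight (entry_wt (fun x => reindex_mx phi (v x))) w K = weight (entry_wt v) w (phi \o K).
Proof. by apply: eq_bigr => l _; rewrite /entry_wt entry_reindex. Qed.

(** The walk [base] stays at [i] until its last step to [j], [spike r] differs from it
in the vertex number [r] only, and [hybrid r] follows the given walk [K] before
position [r] and [base] from there on.  By modularity at inner letters,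
[hybrid r.+1] and [base] together weigh as much as [hybrid r] and [spike r]; as
[base] and [spike r] have at most three vertices, [hybrid r.+1] inherits the weight
of [hybrid r]. *)
Lemma eval_entry_transfer n (v : nat -> ai_mx n S7) s t i j c :
  Id (ai_mx 3 S7) (s, t) -> c <> S7_inf ->
  entry (eval v s) i j = c -> entry (eval v t) i j = c.
Proof.
move=> st cfin sc.
pose phi k (p : 'I_3) := if val p is q.+1 then if q is 0 then j else k else i.
pose p0 : 'I_3 := ord0; pose p1 : 'I_3 := inord 1; pose p2 : 'I_3 := inord 2.
have phi0 k : phi k p0 = i by [].
have phi1 k : phi k p1 = j by rewrite /phi /= inordK.
have phi2 k : phi k p2 = k by rewrite /phi /= inordK.
have three k w K : w \in words t -> walk w p0 p1 K ->
    weight (entry_wt v) w (phi k \o K) = wt c.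
  move=> tw wK; pose u x : ai_mx 3 S7 := @reindex_mx n 3 (phi k) (v x).
  have uc : entry (eval u t) p0 p1 = c.
    rewrite -[eval u t](st u); apply/eval_entryP => // r L rs [L0 L1].
    rewrite weight_reindex; apply: ((eval_entryP v s i j cfin).1 sc) => //.
    by split=> /=; rewrite ?L0 ?L1.
  by rewrite -(@weight_reindex n 3); exact: ((eval_entryP u t p0 p1 cfin).1 uc).
have modular x (tx : inner_letter t x) :=
  inner_letter_modular cfin sc (Id_inner_letter (leqnn 3) st tx).
apply/eval_entryP => // w K tw [K0 K1].
have w0 := size_word tw.
pose base l := if l == size w then j else i.
pose spike r l := if l == r then K r else base l.
pose hybrid r l := if l < r then K l else base l.
have base0 : base 0 = i by rewrite /base ltn_eqF.
have spike_wt r : 0 < r < size w -> weight (entry_wt v) w (spike r) = wt c.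
  case/andP=> r0 rw.
  pose L l := if l == r then p2 else if l == size w then p1 else p0.
  rewrite -(three (K r) w L tw); first last.
    by split; rewrite /L ?(ltn_eqF r0) ?(ltn_eqF w0) ?(gtn_eqF rw) ?eqxx.
  apply: eq_weight => l _; rewrite /spike /base /L /=.
  by case: eqP => _; [rewrite phi2 | case: eqP => _; rewrite ?phi1 ?phi0].
have base_wt : weight (entry_wt v) w base = wt c.
  pose L l := if l == size w then p1 else p0.
  rewrite -(three i w L tw); last by split; rewrite /L ?(ltn_eqF w0) ?eqxx.
  by apply: eq_weight => l _; rewrite /base /L /=; case: eqP => _; rewrite ?phi1 ?phi0.
have hybrid_wt r : r < size w -> weight (entry_wt v) w (hybrid r.+1) = wt c.
  elim: r => [_|r IH rw].
    rewrite -base_wt; apply: eq_weight => -[|l] _ //.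
    by rewrite /hybrid K0 base0.
  (* Replace the copies of wt c by weights of walks, to compare step by step. *)
  apply/(@addIn (wt c)); rewrite -{1}base_wt -{1}(IH (ltnW rw)) -(spike_wt r.+1) //.
  apply: weight_exchange => l lw; rewrite /hybrid /spike.
  have [lr|rl|->] := ltngtP l r.
  - have -> : (l.+1 == r.+1) = false by lia.
    have -> : (l == r.+1) = false by lia.
    have -> : (l.+1 < r.+2) by lia.
    have -> : (l.+1 < r.+1) by lia.
    have -> : (l < r.+2) by lia.
    by have -> : (l < r.+1) by lia.
  - have -> : (l.+1 < r.+2) = false by lia.
    have -> : (l < r.+1) = false by lia.
    have -> : (l.+1 < r.+1) = false by lia.
    have -> : (l.+1 == r.+1) = false by lia.
    have -> : (l < r.+2) = (l == r.+1) by lia.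
    by case: eqP => [->|_]; rewrite 1?addnC.
  have -> : (r == r.+1) = false by lia.
  rewrite !ltnSn ltnn eqxx ltnS leqnSn.
  (* The step entering the new vertex: if it is the first one, its source is i in all
     four walks and its letter need not be inner; otherwise its letter is inner, as
     the vertex number r.+1 is not the last. *)
  case: (posnP r) => [->|r0]; first by rewrite K0 base0 addnC.
  by apply: modular; exists w, r.
have := hybrid_wt (size w).-1; rewrite prednK // => <- //.
apply: eq_weight => l; rewrite /hybrid.
by case: ltngtP => // -> _; rewrite K1 /base eqxx.
Qed.

Lemma Id_mx_ge3 n : 3 <= n -> Id (ai_mx n S7) = Id (ai_mx 3 S7).
Proof.
move=> n3; apply/seteqP; split=> [e|[s t] st v].
  exact: variety_of_Id (variety_of_mx_le n3).
apply: entry_inj => i j; apply: S7_eqP => c cfin; split.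
  exact: eval_entry_transfer.
by apply: eval_entry_transfer => // u; rewrite /= -(st u).
Qed.

Lemma variety_of_mx_ge3 n : 3 <= n ->
  variety_of (ai_mx n S7) = variety_of (ai_mx 3 S7).
Proof.
move=> n3; have [b b_onto] := mx_S7_countable n.
apply: funext => T; apply: propext; split; apply: variety_of_sub.
  by apply: Id_variety_of b_onto _; rewrite Id_mx_ge3.
exact: variety_of_mx_le.
Qed.

(** * Identities separating the varieties *)

Definition comm_id : term * term := (Mul (Var 0) (Var 1), Mul (Var 1) (Var 0)).

Lemma comm_id_S7 : Id S7 comm_id.
Proof. by move=> v /=; case: (v 0); case: (v 1). Qed.

Definition mx_of n (g : nat -> nat -> S7_car) : ai_mx n S7 :=
  (\matrix_(i, j) g i j)%R.

Lemma entry_mx_of n g i j : entry (mx_of n g) i j = g i j.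
Proof. by rewrite /entry mxE. Qed.

Lemma comm_id_mx2 : ~ Id (ai_mx 2 S7) comm_id.
Proof.
pose A := mx_of 2 (fun i j => if (i, j) == (0, 1) then S7_inf else S7_one).
pose B := mx_of 2 (fun _ _ => S7_one).
have one_fin : S7_one <> S7_inf by [].
move=> /(_ (fun x => if x is 0 then A else B)) AB.
have BA1 : entry (ai_mul B A) ord0 ord0 = S7_one.
  by apply/entryMP => // k; rewrite !entry_mx_of /= xpair_eqE andbF.
move: BA1; rewrite -[ai_mul B A]AB => /(entryMP _ _ _ _ one_fin)/(_ (@ord_max 1)).
by rewrite !entry_mx_of.
Qed.

Definition square_sum x := Add (Var x) (Mul (Var x) (Var x)).
Definition square_id : term * term :=
  let s := Add (square_sum 0) (square_sum 1) in (s, Add s (Mul (Var 0) (Var 1))).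

(** An entry of either side involves only six entries of the two matrices, which
leaves finitely many cases. *)
Lemma square_id_mx2 : Id (ai_mx 2 S7) square_id.
Proof.
move=> v; set x := v 0; set y := v 1.
have sum2 (F : 'I_2 -> S7) : ai_sum F = S7_add (F ord0) (F (lift ord0 ord0)).
  by rewrite /ai_sum big_ord_recl big_ord0 /=; case: (F _); case: (F _).
have mulE (A B : ai_mx 2 S7) i j : entry (ai_mul A B) i j =
  S7_add (S7_mul (entry A i ord0) (entry B ord0 j))
         (S7_mul (entry A i (lift ord0 ord0)) (entry B (lift ord0 ord0) j)).
  by rewrite /entry mxE sum2.
have ord2 (i : 'I_2) : i = ord0 \/ i = lift ord0 ord0.
  by case: (unliftP ord0 i) => [k|] ->; [right; rewrite (ord1 k) | left].
apply: entry_inj => i j; rewrite /= -/x -/y !entryD !mulE.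
by case: (ord2 i) => ->; case: (ord2 j) => ->; do 6!case: (entry _ _ _).
Qed.

(** The entry (0, 1) of the left side is a, but x has a in (0, 2) and y has a in (2, 1),
so the walk 0, 2, 1 makes the entry (0, 1) of x y infinite. *)
Lemma square_id_mx3 : ~ Id (ai_mx 3 S7) square_id.
Proof.
pose X := mx_of 3 (fun i j => if (i == 0) && (j != 0) then S7_a else S7_one).
pose Y := mx_of 3 (fun i j => if (i != 1) && (j == 1) then S7_a else S7_one).
pose p0 : 'I_3 := ord0; pose p1 : 'I_3 := Ordinal (isT : 1 < 3).
have afin : S7_a <> S7_inf by [].
move=> /(_ (fun x => if x is 0 then X else Y)) XY.
have sa : entry (ai_add (ai_add X (ai_mul X X)) (ai_add Y (ai_mul Y Y))) p0 p1 = S7_a.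
  rewrite !entryD; apply/S7_addP => //; split; apply/S7_addP => //; split;
    rewrite ?entry_mx_of //; apply/entryMP => // k; rewrite !entry_mx_of.
    by case: k => -[|[|[|]]].
  by case: k => -[|[|[|]]].
move: sa; rewrite [ai_add _ _]XY entryD => /(S7_addP _ _ afin)[_].
by move=> /(entryMP _ _ _ _ afin)/(_ (@ord_max 2)); rewrite !entry_mx_of.
Qed.

(** * The chain of varieties *)

Lemma variety_mx_proper m n e : m <= n -> Id (ai_mx m S7) e -> ~ Id (ai_mx n S7) e ->
  proper_subclass (variety_of (ai_mx m S7)) (variety_of (ai_mx n S7)).
Proof.
move=> mn me ne; split; first exact: variety_of_sub (variety_of_mx_le mn).
move=> /(_ _ (@variety_of_refl _)) nm; apply: ne.
exact: variety_of_Id nm me.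
Qed.

Lemma variety_of_mx1 : variety_of (ai_mx 1 S7) = variety_of S7.
Proof.
have homE : is_hom (fun A : ai_mx 1 S7 => entry A ord0 ord0 : S7).
  split=> A B; first by rewrite entryD.
  by apply: S7_eqP => c cfin; rewrite entryMP // S7_mulP //; split=> [/(_ ord0)|H k];
    rewrite ?(ord1 k).
apply: funext => T; apply: propext; split; apply: variety_of_sub.
  apply: (variety_of_embedding homE) => A B AB; apply: entry_inj => i j.
  by rewrite (ord1 i) (ord1 j).
move=> K [imK _ _] KM; apply: imK KM homE _ => x.
by exists (mx_of 1 (fun _ _ => x)); rewrite entry_mx_of.
Qed.

Lemma proper_subclass_neq K L : proper_subclass K L -> K <> L.
Proof. by case=> _ LK KL; apply: LK; rewrite KL. Qed.

Theorem theorem1p1 :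
  [/\ forall n : nat, 3 <= n ->
        Id (ai_mx n S7) = Id (ai_mx 3 S7) /\
        variety_of (ai_mx n S7) = variety_of (ai_mx 3 S7),
      proper_subclass (variety_of S7) (variety_of (ai_mx 2 S7)),
      proper_subclass (variety_of (ai_mx 2 S7)) (variety_of (ai_mx 3 S7))
    & exists V : 'I_3 -> ai_class,
        injective V /\
        (forall K : ai_class,
          (exists i, K = V i) <->
          (exists2 n : nat, 1 <= n & K = variety_of (ai_mx n S7)))].
Proof.
have comm1 : Id (ai_mx 1 S7) comm_id.
  apply: variety_of_Id comm_id_S7; rewrite -variety_of_mx1.
  exact: variety_of_refl.
have lt12 := variety_mx_proper (isT : 1 <= 2) comm1 comm_id_mx2.
have lt23 := variety_mx_proper (isT : 2 <= 3) square_id_mx2 square_id_mx3.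
have lt13 : proper_subclass (variety_of (ai_mx 1 S7)) (variety_of (ai_mx 3 S7)).
  apply: variety_mx_proper comm1 _ => // c3; apply: comm_id_mx2.
  exact: variety_of_Id (variety_of_mx_le (isT : 2 <= 3)) c3.
split=> //; first by split; [exact: Id_mx_ge3 | exact: variety_of_mx_ge3].
  by rewrite -variety_of_mx1.
exists (fun i => variety_of (ai_mx i.+1 S7)); split.
  have ne12 := proper_subclass_neq lt12.
  have ne23 := proper_subclass_neq lt23.
  have ne13 := proper_subclass_neq lt13.
  move=> i j eV; apply: val_inj => /=; move: eV.
  by case: i j => -[|[|[|]]] // ? [[|[|[|]]]] // ? /= eV; first
    [case: (ne12 eV) | case: (ne23 eV) | case: (ne13 eV)
    | case: (ne12 (esym eV)) | case: (ne23 (esym eV)) | case: (ne13 (esym eV))].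
move=> K; split=> [[i ->]|[n n1 ->]]; first by exists i.+1.
case: n n1 => [|[|[|n]]] // _; [by exists (inord 0); rewrite inordK
  | by exists (inord 1); rewrite inordK | exists (inord 2)].
by rewrite inordK //; exact: variety_of_mx_ge3.
Qed.
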